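(* Let $(G,K)$ be a Gelfand pair with dual space $Z$ and Plancherel measure $\nu$, and let $L$ be a locally compact group. Let $h:\operatorname{supp}(\nu)\times L\to\mathbb{C}$ be a continuous function satisfying (i) for each $\varphi\in\operatorname{supp}(\nu)$ we have $h(\varphi,\cdot)\in\mathcal{P}(L)$; (ii) $\int_Z h(\varphi,e_L)\,d\nu(\varphi)<\infty$. Then $C:G\times L\to\mathbb{C}$ defined by $$C(x,u)=\int_Z\varphi(x)\,h(\varphi,u)\,d\nu(\varphi)$$ belongs to $\mathcal{P}_K^\sharp(G,L)$.
   Context: For a locally compact group $G$, $e_G$ is the neutral element and $\omega_G$ a left Haar measure. A function $f:G\to\mathbb{C}$ is positive definite if for all $n\in\mathbb{N}$ and $u_1,\dots,u_n\in G$ one has $\sum_{k,l=1}^n f(u_k^{-1}u_l)a_k\overline{a_l}\ge 0$ for all $(a_1,\dots,a_n)\in\mathbb{C}^n$. $\mathcal{P}(G)$ is the set of continuous positive definite functions on $G$. A Gelfand pair $(G,K)$ consists of a locally compact group $G$ and a compact subgroup $K$ such that the convolution algebra $C_c(G)_K^\sharp$ of $K$-bi-invariant continuous compactly supported functions on $G$ is commutative; then $G$ is unimodular. $K$-bi-invariance of $f$ means $f(kxk')=f(x)$ for $x\in G$, $k,k'\in K$. For $K$, $\omega_K$ is normalized by $\omega_K(K)=1$. A spherical function for $(G,K)$ is a continuous $\varphi:G\to\mathbb{C}$ with $\varphi(e_G)=1$ and $\int_K\varphi(ukv)\,d\omega_K(k)=\varphi(u)\varphi(v)$ for $u,v\in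 G$. The dual space $Z$ is the set of positive definite spherical functions, with the (locally compact) topology of uniform convergence on compact subsets of $G$. With $\mathcal{F}f(\varphi)=\int_G\overline{\varphi(u)}f(u)\,d\omega_G(u)$, the Plancherel measure $\nu$ is the unique positive Radon measure on $Z$ with $\int_G|f|^2\,d\omega_G=\int_Z|\mathcal{F}f|^2\,d\nu$ for all $f\in C_c(G)_K^\sharp$; $\operatorname{supp}(\nu)$ is its support (possibly smaller than $Z$). Integrals over $Z$ with respect to $\nu$ of functions defined only on $\operatorname{supp}(\nu)$ are understood as integrals over $\operatorname{supp}(\nu)$. $\mathcal{P}_K^\sharp(G,L)$ is the set of continuous positive definite functions on the product group $G\times L$ which are $K$-bi-invariant in the first variable, i.e. $f(kxk',u)=f(x,u)$. *)

(* Defs.v *)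
From HB Require Import structures.
From mathcomp Require Import all_boot all_order all_algebra.
From mathcomp Require Import complex.
From mathcomp Require Import all_classical all_reals all_analysis.

Set Implicit Arguments.
Unset Strict Implicit.
Unset Printing Implicit Defensive.

Import Order.TTheory GRing.Theory Num.Theory.
Import numFieldNormedType.Exports.

Local Open Scope classical_set_scope.
Local Open Scope ring_scope.

(* The usual topology of the complex numbers. *)
HB.instance Definition _ (R : realType) := NormedModule.copy R[i] (R[i]^o).

(* The base point only serves to form measurableTypes, which are pointed; it
   is unrelated to the group structure. *)
HB.mixin Record isTopologicalGroup G of PointedTopological G & Group G := {
  mulg_continuous : continuous (fun p : G * G => p.1 * p.2)%g ;
  invg_continuous : continuous (fun x : G => x^-1)%g
}.

#[short(type="topologicalGroupType")]
HB.structure Definition TopologicalGroup :=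
  {G of PointedTopological G & Group G & isTopologicalGroup G}.

Lemma continuous_pairing (T U V : topologicalType) (f : T -> U) (g : T -> V) :
  continuous f -> continuous g -> continuous (fun x => (f x, g x)).
Proof. by move=> cf cg x; apply: cvg_pair; [exact: cf | exact: cg]. Qed.

Lemma continuous_compose (T U V : topologicalType) (f : T -> U) (g : U -> V) :
  continuous f -> continuous g -> continuous (fun x => g (f x)).
Proof. by move=> cf cg x; apply: continuous_comp; [exact: cf | exact: cg]. Qed.

Lemma continuous_mulg (T : topologicalType) (G : topologicalGroupType)
    (f g : T -> G) :
  continuous f -> continuous g -> continuous (fun x => f x * g x)%g.
Proof.
move=> cf cg.
exact: (continuous_compose (continuous_pairing cf cg) mulg_continuous).
Qed.

Lemma continuous_invg (T : topologicalType) (G : topologicalGroupType)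
    (f : T -> G) :
  continuous f -> continuous (fun x => (f x)^-1)%g.
Proof. by move=> cf; exact: (continuous_compose cf invg_continuous). Qed.

Section prod_topological_group.
Context (G L : topologicalGroupType).

Let cfst (T U : topologicalType) : continuous (@fst T U).
Proof. by move=> x; exact: cvg_fst. Qed.

Let csnd (T U : topologicalType) : continuous (@snd T U).
Proof. by move=> x; exact: cvg_snd. Qed.

Let mulg_continuous_prod :
  continuous (fun p : (G * L) * (G * L) => p.1 * p.2)%g.
Proof.
apply: continuous_pairing; apply: continuous_mulg;
  by apply: continuous_compose; (exact: cfst || exact: csnd).
Qed.

Let invg_continuous_prod : continuous (fun x : G * L => x^-1)%g.
Proof.
by apply: continuous_pairing; apply: continuous_invg;
  [exact: cfst | exact: csnd].
Qed.

HB.instance Definition _ := isTopologicalGroup.Build (G * L)%type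
  mulg_continuous_prod invg_continuous_prod.

End prod_topological_group.

Definition locally_compact_group (G : topologicalGroupType) : Prop :=
  hausdorff_space G /\ locally_compact [set: G].

Record compactSubgroup (G : topologicalGroupType) := CompactSubgroup {
  subgroup_set :> set G ;
  subgroup1 : subgroup_set 1%g ;
  subgroupM : forall x y,
    subgroup_set x -> subgroup_set y -> subgroup_set (x * y)%g ;
  subgroupV : forall x, subgroup_set x -> subgroup_set (x^-1)%g ;
  subgroup_compact : compact subgroup_set
}.

(* K as a topological group of its own, with the topology induced by G. *)
Definition subgroup_type (G : topologicalGroupType) (K : compactSubgroup G)
  : Type := set_type K.

Section subgroup_topological_group.
Context (G : topologicalGroupType) (K : compactSubgroup G).

HB.instance Definition _ := SubType.on (subgroup_type K).
HB.instance Definition _ := Topological.copy (subgroup_type K) (set_type K).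

Let closedK : group_closed (fun x : G => x \in (K : set G)).
Proof.
split; first by apply/mem_set; exact: subgroup1.
move=> x y /set_mem Kx /set_mem Ky; apply/mem_set.
by apply: subgroupM => //; exact: subgroupV.
Qed.

HB.instance Definition _ :=
  SubChoice_isSubGroup.Build G _ (subgroup_type K) closedK.
HB.instance Definition _ := isPointed.Build (subgroup_type K) 1%g.

Let val_continuous : continuous (val : subgroup_type K -> G).
Proof. exact: (@initial_continuous (set_type K) G set_val). Qed.

Let mulg_continuous_sub : continuous
  (fun p : subgroup_type K * subgroup_type K => p.1 * p.2)%g.
Proof.
apply: (@continuous_comp_initial (set_type K) _ G set_val).
apply: continuous_mulg; apply: continuous_compose;
  by [exact: val_continuous | move=> x; exact: cvg_fst | move=> x; exact: cvg_snd].
Qed.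

Let invg_continuous_sub : continuous (fun x : subgroup_type K => x^-1)%g.
Proof.
apply: (@continuous_comp_initial (set_type K) _ G set_val).
by apply: continuous_invg; exact: val_continuous.
Qed.

HB.instance Definition _ := isTopologicalGroup.Build (subgroup_type K)
  mulg_continuous_sub invg_continuous_sub.

End subgroup_topological_group.

Definition borel (T : ptopologicalType) := g_sigma_algebraType (@open T).

HB.instance Definition _ (T : ptopologicalType) := Measurable.on (borel T).

Section complex_integral.
Context {d : measure_display} {T : measurableType d} {R : realType}.
Variables (mu : {measure set T -> \bar R}) (D : set T) (f : T -> R[i]).

Definition cintegrable : Prop :=
  mu.-integrable D (fun x => (complex.Re (f x))%:E) /\
  mu.-integrable D (fun x => (complex.Im (f x))%:E).

Definition cintegral : R[i] := Complex
  (\int[mu]_(x in D) complex.Re (f x)) (\int[mu]_(x in D) complex.Im (f x)).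

End complex_integral.

Section radon_measure.
Context {R : realType} {T : ptopologicalType}.
Variable mu : {measure set (borel T) -> \bar R}.

(* Radon measures are taken to be inner regular on all Borel sets; their
   integrals of integrable continuous functions are those given by the other usual
   convention (outer regular, and inner regular on open sets). *)
Definition radon_measure : Prop :=
  (forall Q : set T, compact Q -> (mu Q < +oo)%E) /\
  (forall B : set (borel T), measurable B ->
    mu B = ereal_sup [set mu Q | Q in [set Q : set T | compact Q /\ Q `<=` B]]).

Definition supp : set T :=
  [set x | forall U : set T, open U -> U x -> (0 < mu U)%E].

End radon_measure.

Definition left_haar_measure {R : realType} {G : topologicalGroupType}
    (mu : {measure set (borel G) -> \bar R}) : Prop :=
  [/\ radon_measure mu,
      mu [set: G] != 0%E &
      forall (x : G) (B : set (borel G)), measurable B ->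
        mu [set (x * y)%g | y in (B : set G)] = mu B].

Section positive_definite.
Context {R : realType}.

Definition positive_definite (G : groupType) (f : G -> R[i]) : Prop :=
  forall (n : nat) (u : 'I_n -> G) (a : 'I_n -> R[i]),
    0 <= \sum_(k < n) \sum_(l < n) f ((u k)^-1 * u l)%g * a k * (a l)^*.

Definition continuous_positive_definite (G : topologicalGroupType)
    : set (G -> R[i]) :=
  [set f | continuous f /\ positive_definite f].

Definition positive_definite_biinvariant (G : topologicalGroupType)
    (K : compactSubgroup G) (L : topologicalGroupType)
    : set (G * L -> R[i]) :=
  [set f | @continuous_positive_definite (G * L)%type f /\
    forall (k k' x : G) (u : L), subgroup_set K k -> subgroup_set K k' ->
      f ((k * x * k')%g, u) = f (x, u)].

End positive_definite.

Section gelfand.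
Context {R : realType} {G : topologicalGroupType} (K : compactSubgroup G).
Implicit Types (omG : {measure set (borel G) -> \bar R}) (f g : G -> R[i]).

Definition biinvariant f : Prop :=
  forall k k' x : G, subgroup_set K k -> subgroup_set K k' -> f (k * x * k')%g = f x.

Definition compactly_supported_biinvariant : set (G -> R[i]) :=
  [set f | [/\ continuous f, compact (closure [set x | f x != 0])
             & biinvariant f]].

Definition convolution omG f g (x : G) : R[i] :=
  cintegral omG setT (fun y : borel G => f y * g ((y : G)^-1 * x)%g).

Definition gelfand_pair omG : Prop :=
  locally_compact_group G /\
  forall f g, compactly_supported_biinvariant f ->
    compactly_supported_biinvariant g ->
    convolution omG f g = convolution omG g f.

End gelfand.

Section dual_space.
Context {R : realType} {G : topologicalGroupType} {K : compactSubgroup G}.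

(* Intended for the Haar measure of K, normalized by omK(K) = 1: the total
   mass is built into the type, invariance is assumed separately. *)
Variable omK : probability (borel (subgroup_type K)) R.

Definition spherical (phi : G -> R[i]) : Prop :=
  [/\ continuous phi, phi 1%g = 1 &
      forall u v : G,
        cintegral omK setT
          (fun k : borel (subgroup_type K) =>
             phi (u * val (k : subgroup_type K) * v)%g) = phi u * phi v].

Definition positive_spherical : set {family compact, G -> R[i]} :=
  [set phi | spherical phi /\ positive_definite phi].

Lemma positive_spherical1 : positive_spherical (fun=> 1).
Proof.
split; first split => //.
- by move=> x; exact: cvg_cst.
- move=> u v; rewrite mulr1 /cintegral.
  rewrite [X in Complex X _]/Rintegral [X in Complex _ X]/Rintegral /=.
  rewrite !integral_cst//= probability_setT mul0e mule1 /=.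
  by [].
- move=> n u a.
  under eq_bigr do under eq_bigr do rewrite mul1r.
  under eq_bigr do rewrite -mulr_sumr.
  by rewrite -mulr_suml -rmorph_sum/= mul_conjC_ge0.
Qed.

(* The topology is that of uniform convergence on compact subsets of G. *)
Definition dual_space : Type := set_type positive_spherical.

HB.instance Definition _ := SubType.on dual_space.
HB.instance Definition _ :=
  Topological.copy dual_space (set_type positive_spherical).
HB.instance Definition _ := isPointed.Build dual_space
  (exist _ (fun=> 1) (mem_set positive_spherical1)).

Definition dual_fun (phi : dual_space) : G -> R[i] := val phi.

Definition fourier (omG : {measure set (borel G) -> \bar R}) (f : G -> R[i])
    (phi : dual_space) : R[i] :=
  cintegral omG setT (fun u : borel G => (dual_fun phi u)^* * f u).

Definition plancherel_measure (omG : {measure set (borel G) -> \bar R})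
    (nu : {measure set (borel dual_space) -> \bar R}) : Prop :=
  radon_measure nu /\
  forall f, compactly_supported_biinvariant K f ->
    (\int[omG]_u ((Normc.normc (f u)) ^+ 2)%:E =
     \int[nu]_phi ((Normc.normc (fourier omG f phi)) ^+ 2)%:E)%E.

End dual_space.

Coercion dual_fun : dual_space >-> Funclass.

(* Main.v *)
Require Import Defs.
From mathcomp Require Import all_boot all_order all_algebra.
From mathcomp Require Import complex ring.
From mathcomp Require Import all_classical all_reals all_analysis.
From mathcomp Require Import measurable_realfun.
Import Order.TTheory GRing.Theory Num.Theory.
Import numFieldNormedType.Exports.
Local Open Scope classical_set_scope.
Local Open Scope ring_scope.

(** Write [C(x, u)] for the integral of [phi x * h phi u] over the support of
[nu]. Positive definite functions are bounded by their value at the neutral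
element, so the integrand is dominated by [h phi 1], which is integrable, and it
is measurable because it is continuous on the closed set [supp nu].

Positive definiteness of [C] holds under the integral sign: each integrand is
the product of two positive definite functions on [G * L], pulled back from the
factors, and such a product is positive definite by Schur's theorem
([positive_definiteM], from the spectral theorem).

Bi-invariance of [C] comes from that of each spherical function. Left invariance
of the Haar measure of [K] shows that [phi] is 1 on [K]
([positive_spherical_subgroup]), and a positive definite function that takes at
[k] its value at the neutral element is invariant under right translation by
[k] ([positive_definite_translate]).

Continuity of [C] is the delicate point: [G * L] is not assumed to be first
countable, so that dominated convergence does not suffice. As [nu] is Radon,
the finite measure [h phi 1 dnu] is concentrated on a compact set up to any
given error ([radon_tight]); over a compact set the tube lemma turns the joint
continuity of the integrand, which rests on the local compactness of [G]
([dual_eval_continuous]), into uniform convergence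
([continuous_Rintegral]). *)

Set Implicit Arguments.
Unset Strict Implicit.
Unset Printing Implicit Defensive.

(** * Borel sets and Radon measures *)

Lemma borel_open (T : ptopologicalType) (U : set T) :
  open U -> measurable (U : set (borel T)).
Proof. exact: (@sub_sigma_algebra T setT open). Qed.

Lemma borel_closed (T : ptopologicalType) (F : set T) :
  closed F -> measurable (F : set (borel T)).
Proof.
move=> cF; rewrite -(setCK F).
by apply: (@measurableC _ (borel T)); exact: borel_open (closed_openC cF).
Qed.

Lemma borel_measurable_within (R : realType) (T : ptopologicalType) (S : set T)
    (f : T -> R) :
  {within S, continuous f} -> measurable_fun (S : set (borel T)) f.
Proof.
move=> /continuousP cf mS; apply: (measurability _ (RGenOpens.measurableE R)).
move=> _ [_ [a [b ->] <-]].
have /open_subspaceP[U oU US] : open (from_subspace S f @^-1` `]a, b[).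
  by apply: cf; exact: interval_open.
rewrite [X in measurable X](_ : _ = U `&` S); last by rewrite setIC -US.
by apply: measurableI => //; exact: borel_open.
by [].
Qed.

Lemma closed_supp (R : realType) (T : ptopologicalType)
    (mu : {measure set (borel T) -> \bar R}) : closed (supp mu).
Proof.
rewrite -[supp mu]setCK; apply: open_closedC.
rewrite openE => x /= /existsNP[U /not_implyP[oU /not_implyP[Ux mU]]].
rewrite /interior nbhsE; exists U; first by split.
by move=> y Uy /(_ U oU Uy).
Qed.

Lemma borel_measurable_fun (T U : ptopologicalType) (f : T -> U) :
  continuous f -> measurable_fun setT (f : borel T -> borel U).
Proof.
move=> /continuousP cf.
apply: (@measurability _ _ (borel T) (borel U) _ _ (@open U)) => //.
by move=> _ [B oB <-]; rewrite setTI; apply: borel_open; exact: cf.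
Qed.

(** The finite measure with density [g] inherits inner regularity from [mu],
which may itself be infinite on [S]: up to a small [g]-mass, [S] can be
replaced by a level set where [g] is bounded below, such a level set has finite
measure by Markov's inequality, and there inner regularity leaves out a set of
small measure, whose [g]-mass is small by absolute continuity. *)
Lemma radon_tight (R : realType) (T : ptopologicalType)
    (mu : {measure set (borel T) -> \bar R}) (S : set T) (g : T -> R) (e : R) :
  hausdorff_space T -> radon_measure mu -> measurable (S : set (borel T)) ->
  (forall x, S x -> 0 <= g x) ->
  mu.-integrable (S : set (borel T)) (EFin \o g) -> 0 < e ->
  exists Q : set T, [/\ compact Q, Q `<=` S &
    \int[mu]_(x in (S `\` Q : set (borel T))) g x < e].
Proof.
move=> hT [Kfin inreg] mS g0 ig e0.
have /integrableP[mg goo] := ig.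
have mg' : measurable_fun (S : set (borel T)) g by exact/measurable_EFinP.
have e20 : 0 < e / 2 by rewrite divr_gt0.
pose B n : set (borel T) := S `&` [set x | (n.+1%:R)^-1 <= g x].
have mB n : measurable (B n).
  rewrite /B (_ : [set x | _] = g @^-1` `[n.+1%:R^-1, +oo[%classic).
    by apply: mg' => //; exact: measurable_itv.
  by apply/seteqP; split=> x /=; rewrite in_itv /= andbT.
have BS n : B n `<=` S by move=> x [].
have igS (A : set (borel T)) : measurable A -> A `<=` S ->
    mu.-integrable A (EFin \o g).
  by move=> mA AS; apply: integrableS ig.
(* Markov's inequality *)
have Bfin n : (mu (B n) < +oo)%E.
  have n0 : (0 : R) < n.+1%:R^-1 by rewrite invr_gt0.
  have Bg : ((n.+1%:R^-1)%:E * mu (B n) <= \int[mu]_(x in B n) (g x)%:E)%E.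
    rewrite -integral_cst//; apply: ge0_le_integral => //=.
    - exact: measurable_int (igS _ (mB n) (BS n)).
    - by move=> x []; rewrite lee_fin.
  rewrite ltey; apply/eqP => Boo; move: Bg; rewrite Boo gt0_muley ?lte_fin//.
  have := integrable_fin_num (mB n) (igS _ (mB n) (BS n)).
  by rewrite fin_numE => /andP[_ /negPf Bn]; rewrite leye_eq Bn.
(* the sets B n increase to the part of S where g does not vanish *)
have [n Bn] : exists n, \int[mu]_(x in S `\` B n) g x < e / 2.
  have UB : \bigcup_n B n = S `&` [set x | g x != 0].
    apply/seteqP; split => x.
      case=> n _ [Sx /= gx]; split => //=.
      exact: lt0r_neq0 (lt_le_trans _ gx).
    move=> [Sx /= gx]; have gx0 : 0 < g x by rewrite lt_neqAle eq_sym gx g0.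
    exists (Num.truncn (g x)^-1) => //; split => //=.
    by rewrite invf_ple ?posrE// ltW// truncnS_gt.
  have nB : nondecreasing_seq B.
    move=> m n mn; rewrite subsetEset => x [Sx /= gx]; split => //=.
    by apply: le_trans gx; rewrite lef_pV2 ?posrE// ler_nat ltnS.
  have := @ge0_nondecreasing_set_cvg_integral _ _ _ B (EFin \o g) mu nB mB
    (fun n => measurable_int mu (igS _ (mB n) (BS n)))
    (fun n x Bx => g0 x (BS n x Bx)).
  have mN0 : measurable (S `&` [set x | g x != 0] : set (borel T)).
    by rewrite -UB; exact: bigcupT_measurable.
  rewrite UB; set J := (X in _ --> X).
  have -> : J = (\int[mu]_(x in S) g x)%:E.
    rewrite /J/Rintegral fineK; last exact: integrable_fin_num.
    rewrite integral_mkcondr; apply: eq_integral => x _.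
    rewrite /= patchE; case: ifPn => //; rewrite notin_setE /= => /negP.
    by rewrite negbK => /eqP ->.
  move=> /fine_cvg /cvgr_gt/(_ (\int[mu]_(x in S) g x - e / 2)).
  rewrite ltrBlDr ltrDl => /(_ e20) [n _ /(_ n (leqnn n)) /= Bn].
  exists n.
  have SE : (S : set (borel T)) = B n `|` (S `\` B n) by rewrite setDUK.
  move: Bn; rewrite ltrBlDr {1}SE Rintegral_setU//=.
  - by rewrite ltrD2l.
  - exact: measurableD.
  - by rewrite -SE.
  - by rewrite disj_set2E setDIK.
have ig' : mu.-integrable setT (EFin \o (g \_ S)).
  by rewrite -restrict_EFin; exact/(integrable_mkcond _ mS).
have [d [d0 gd]] := integral_normr_continuous ig' e20.
have [Q [cQ QB BQd]] : exists Q : set T,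
    [/\ compact Q, Q `<=` B n & (mu (B n `\` Q) < d%:E)%E].
  have := inreg _ (mB n) => Bsup.
  have Bf : mu (B n) \is a fin_num by rewrite ge0_fin_numE.
  move: (Bf); rewrite {1}Bsup => /(ub_ereal_sup_adherent d0).
  case=> _ [Q [cQ QB] <-]; rewrite -Bsup => dQ; exists Q; split => //.
  have mQ : measurable (Q : set (borel T)).
    exact: borel_closed (compact_closed hT cQ).
  rewrite measureD//; last exact: Bfin.
  have -> : (B n `&` Q : set (borel T)) = Q by exact/setIidr.
  have Qf : mu Q \is a fin_num by rewrite ge0_fin_numE// Kfin.
  by move: dQ; rewrite lteBlDr// lteBlDl// addeC.
exists Q; split => //; first exact: subset_trans QB _.
have mQ : measurable (Q : set (borel T)).
  exact: borel_closed (compact_closed hT cQ).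
have mBQ : measurable (B n `\` Q : set (borel T)) by exact: measurableD.
have mSB : measurable (S `\` B n : set (borel T)) by exact: measurableD.
have SQE : (S `\` Q : set (borel T)) = (S `\` B n) `|` (B n `\` Q).
  apply/seteqP; split => x /=.
    by move=> [Sx Qx]; have [Bx|Bx] := pselect (B n x); [right|left].
  by move=> [[Sx Bx]|[/BS Sx Qx]]; split => // /QB.
rewrite SQE Rintegral_setU//=; last 2 first.
- by rewrite -SQE; apply: igS; [exact: measurableD | move=> x []].
- by rewrite disj_set2E; apply/eqP/seteqP; split => // x /= [[_ nBx] [/nBx]].
rewrite [ltRHS](splitr e) ltrD//.
move: (gd _ mBQ BQd); rewrite (@eq_Rintegral _ (borel T) _ _ _ g)// => x.
rewrite inE => -[/BS Sx _].
by rewrite /patch mem_set// ger0_norm// g0.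
Qed.

(** Continuity under the integral sign along arbitrary filters of the parameter
space. Dominated convergence only reaches sequences, and [W] need not be first
countable; instead, [radon_tight] reduces the domain to a compact [Q], up to an
error which the domination controls uniformly in the parameter, and on [Q] the
joint continuity of [F] makes the convergence uniform. *)
Lemma continuous_Rintegral (R : realType) (T : ptopologicalType)
    (W : topologicalType) (mu : {measure set (borel T) -> \bar R})
    (S : set T) (F : T -> W -> R) (g : T -> R) :
  hausdorff_space T -> radon_measure mu -> measurable (S : set (borel T)) ->
  {within S `*` setT, continuous (fun p => F p.1 p.2)} ->
  (forall w, mu.-integrable (S : set (borel T)) (EFin \o F ^~ w)) ->
  (forall x w, S x -> `|F x w| <= g x) ->
  mu.-integrable (S : set (borel T)) (EFin \o g) ->
  continuous (fun w => \int[mu]_(x in (S : set (borel T))) F x w).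
Proof.
move=> hT rmu mS cF iF Fg ig w0; apply/cvgrPdist_lt => e e0.
have e20 : 0 < e / 2 by rewrite divr_gt0.
have e40 : 0 < e / 4 by rewrite divr_gt0.
have g0 x : S x -> 0 <= g x by move=> Sx; exact: le_trans (Fg x w0 Sx).
have [Q [cQ QS gQ]] := radon_tight hT rmu mS g0 ig e40.
have mQ : measurable (Q : set (borel T)).
  exact: borel_closed (compact_closed hT cQ).
have mSQ : measurable (S `\` Q : set (borel T)) by exact: measurableD.
have Qfin : (mu Q < +oo)%E by case: rmu => + _; apply.
set m := fine (mu Q).
have m0 : 0 <= m by exact: fine_ge0.
(* m + 1 instead of m, as Q may have measure 0 *)
pose d := e / 2 / (m + 1).
have d0 : 0 < d by rewrite divr_gt0// ltr_wpDl.
(* the tube lemma over the compact set Q *)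
have near_w0 : \forall w \near w0,
    Q `<=` [set x | S x -> `|F x w0 - F x w| < d].
  move/compact_near_coveringP: cQ; apply => x Qx.
  have d20 : 0 < d / 2 by rewrite divr_gt0.
  have Sx := QS _ Qx.
  have /subspace_continuousP/(_ (x, w0)) := cF.
  move=> /(_ (conj Sx I)) /cvgrPdist_lt/(_ _ d20) /=.
  rewrite near_withinE => -[[U V] /= [Ux Vw0] UV].
  exists (U, V) => // -[y w] /= [Uy Vw] Sy.
  have Fy w' : V w' -> `|F x w0 - F y w'| < d / 2.
    by move=> Vw'; apply: (UV (y, w')).
  rewrite (splitr d) -(subrKA (F x w0)) (le_lt_trans (ler_normD _ _))//.
  rewrite ltrD// ?Fy// distrC Fy//.
  exact: nbhs_singleton.
near=> w.
have iFS (A : set (borel T)) f : measurable A -> A `<=` S ->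
    mu.-integrable (S : set (borel T)) (EFin \o f) ->
    mu.-integrable A (EFin \o f).
  by move=> mA AS; exact: integrableS.
have iD : mu.-integrable (S : set (borel T))
    (EFin \o (fun x => F x w0 - F x w)).
  rewrite (_ : _ \o _ = (EFin \o F ^~ w0) \- (EFin \o F ^~ w))%E//.
  exact: integrableB.
have iN : mu.-integrable (S : set (borel T))
    (EFin \o (fun x => `|F x w0 - F x w|)).
  exact: integrable_norm.
rewrite -RintegralB//.
apply: le_lt_trans (le_normr_Rintegral _ _) _ => //.
have SE : (S : set (borel T)) = Q `|` (S `\` Q) by rewrite setDUK.
rewrite {1}SE Rintegral_setU//; last 2 first.
- by rewrite -SE.
- by rewrite disj_set2E setDIK.
rewrite (splitr e) ltr_leD//.
  apply: (@le_lt_trans _ _ (\int[mu]_(x in (Q : set (borel T))) d)).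
    apply: le_Rintegral => //; first exact: iFS.
      apply/integrableP; split; first exact: measurable_cst.
      rewrite -[X in (X < _)%E]/(
        \int[mu]_(x in (Q : set (borel T))) cst `|d|%:E x)%E.
      by rewrite integral_cst// lte_mul_pinfty// lee_fin.
    move=> x Qx; apply: ltW; move: (QS _ Qx); move: x Qx.
    by near: w.
  rewrite Rintegral_cst// -/m /d -(mulrA (e / 2)) gtr_pMr//.
  rewrite mulrC ltr_pdivrMr ?mul1r ?ltrDl//.
  by rewrite ltr_wpDl.
apply: (@le_trans _ _ (\int[mu]_(x in (S `\` Q : set (borel T))) (2 * g x))).
  apply: le_Rintegral => //.
  - by apply: iFS => // x [].
  - rewrite (_ : _ \o _ = (fun x => 2%:E * (EFin \o g) x))%E//.
    by apply: integrableZl => //; apply: iFS => // x [].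
  - move=> x [Sx _]; rewrite (le_trans (ler_normB _ _))// mulr_natl mulr2n.
    by rewrite lerD// Fg.
rewrite RintegralZl//; last by apply: iFS => // x [].
rewrite mulrC -ler_pdivlMr// ltW// (lt_le_trans gQ)//.
by rewrite -mulrA -invfM -natrM.
Unshelve. all: by end_near. Qed.

(** * Integrals of complex functions *)

Section complex_integral_theory.
Context {d : measure_display} {T : measurableType d} {R : realType}.
Context (mu : {measure set T -> \bar R}) (D : set T) (mD : measurable D).
Implicit Types f g : T -> R[i].

Lemma cintegrableD f g : cintegrable mu D f -> cintegrable mu D g ->
  cintegrable mu D (fun x => f x + g x).
Proof.
move=> [rf jf] [rg jg]; split.
  rewrite (_ : (fun x => _) =
    (fun x => (complex.Re (f x))%:E + (complex.Re (g x))%:E)%E);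
    first exact: integrableD.
  by apply/funext => x; case: (f x); case: (g x).
rewrite (_ : (fun x => _) =
  (fun x => (complex.Im (f x))%:E + (complex.Im (g x))%:E)%E);
  first exact: integrableD.
by apply/funext => x; case: (f x); case: (g x).
Qed.

Lemma cintegrableZr f (c : R[i]) : cintegrable mu D f ->
  cintegrable mu D (fun x => f x * c).
Proof.
case: c => a b [rf jf]; split.
  rewrite (_ : (fun x => _) =
    (fun x => (complex.Re (f x))%:E * a%:E - (complex.Im (f x))%:E * b%:E)%E).
    by apply: integrableB => //; exact: integrableZr.
  by apply/funext => x; case: (f x).
rewrite (_ : (fun x => _) =
    (fun x => (complex.Re (f x))%:E * b%:E + (complex.Im (f x))%:E * a%:E)%E).
  by apply: integrableD => //; exact: integrableZr.
by apply/funext => x; case: (f x).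
Qed.

Lemma cintegralD f g : cintegrable mu D f -> cintegrable mu D g ->
  cintegral mu D (fun x => f x + g x) = cintegral mu D f + cintegral mu D g.
Proof.
move=> [rf jf] [rg jg]; rewrite /cintegral /=.
apply/eqP; rewrite eq_complex /=; apply/andP; split; apply/eqP.
  rewrite -RintegralD//; apply: eq_Rintegral => x _.
  by case: (f x); case: (g x).
by rewrite -RintegralD//; apply: eq_Rintegral => x _; case: (f x); case: (g x).
Qed.

Lemma cintegralZr f (c : R[i]) : cintegrable mu D f ->
  cintegral mu D (fun x => f x * c) = cintegral mu D f * c.
Proof.
case: c => a b [rf jf]; have rZ := fun c => integrableZr mD c rf.
have jZ := fun c => integrableZr mD c jf.
rewrite /cintegral; apply/eqP; rewrite eq_complex /=.
apply/andP; split; apply/eqP.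
  rewrite -!RintegralZr// -RintegralB//; [|exact: rZ|exact: jZ].
  by apply: eq_Rintegral => x _; case: (f x).
rewrite -!RintegralZr// -RintegralD//; [|exact: rZ|exact: jZ].
by apply: eq_Rintegral => x _; case: (f x).
Qed.

Lemma cintegral0 : cintegral mu D (fun=> 0) = 0.
Proof. by rewrite /cintegral/= /Rintegral integral0_eq. Qed.

Lemma cintegrable0 : cintegrable mu D (fun=> 0).
Proof. by split; exact: integrable0. Qed.

Lemma cintegrable_sum I (r : seq I) (F : I -> T -> R[i]) :
  (forall i, cintegrable mu D (F i)) ->
  cintegrable mu D (fun x => \sum_(i <- r) F i x).
Proof.
move=> iF; elim: r => [|i r IH].
  by under eq_fun do rewrite big_nil; exact: cintegrable0.
by under eq_fun do rewrite big_cons; exact: cintegrableD.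
Qed.

Lemma cintegral_sum I (r : seq I) (F : I -> T -> R[i]) :
  (forall i, cintegrable mu D (F i)) ->
  cintegral mu D (fun x => \sum_(i <- r) F i x) =
  \sum_(i <- r) cintegral mu D (F i).
Proof.
move=> iF; elim: r => [|i r IH].
  by rewrite big_nil; under eq_fun do rewrite big_nil; exact: cintegral0.
rewrite big_cons -IH -cintegralD//; last exact: cintegrable_sum.
by under eq_fun do rewrite big_cons.
Qed.

Lemma cintegral_ge0 f : (forall x, D x -> 0 <= f x) -> 0 <= cintegral mu D f.
Proof.
move=> f0; rewrite lecE /=; apply/andP; split.
  rewrite /Rintegral integral0_eq// => x /f0.
  by rewrite lecE => /andP[/eqP ->].
by apply: Rintegral_ge0 => x /f0; rewrite lecE => /andP[].
Qed.

Lemma eq_cintegral f g : (forall x, D x -> f x = g x) ->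
  cintegral mu D f = cintegral mu D g.
Proof.
by move=> fg; rewrite /cintegral; congr Complex;
  apply: eq_Rintegral => x /set_mem/fg ->.
Qed.

End complex_integral_theory.

Section complex_continuity.
Context {R : realType}.

Lemma norm_i : `|'i%C| = 1 :> R[i].
Proof. by rewrite normc_def /= expr0n expr1n add0r sqrtr1. Qed.

Lemma normc_le_Re_Im (z : R[i]) :
  `|z| <= (`|complex.Re z| + `|complex.Im z|)%:C%C.
Proof.
rewrite {1}(complexE z) (le_trans (ler_normD _ _))// normrM.
have normR (x : R) : `|x%:C%C| = `|x|%:C%C.
  by rewrite normc_def /= expr0n addr0 sqrtr_sqr.
by rewrite norm_i mul1r !normR rmorphD.
Qed.

Lemma normc_ge_Im (z : R[i]) : (`|complex.Im z|)%:C%C <= `|z|.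
Proof.
have := normc_ge_Re (z * - 'i%C).
by rewrite normrM normrN norm_i mulr1 mulrN raddfN /= ReiNIm opprK.
Qed.

Lemma Re_continuous : continuous (@complex.Re R : R[i] -> R).
Proof.
move=> z; apply/(@cvgrPdist_lt _ _ _ (nbhs z)) => e e0.
have e0C : (0 : R[i]) < e%:C%C by rewrite ltcR.
have zb : nbhs z (ball z e%:C%C) by exact: nbhsx_ballx.
apply: filterS zb => w zw.
have := le_lt_trans (normc_ge_Re (z - w)) zw.
by rewrite ltcR raddfB.
Qed.

Lemma Im_continuous : continuous (@complex.Im R : R[i] -> R).
Proof.
move=> z; apply/(@cvgrPdist_lt _ _ _ (nbhs z)) => e e0.
have e0C : (0 : R[i]) < e%:C%C by rewrite ltcR.
have zb : nbhs z (ball z e%:C%C) by exact: nbhsx_ballx.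
apply: filterS zb => w zw.
have := le_lt_trans (normc_ge_Im (z - w)) zw.
by rewrite ltcR raddfB.
Qed.

Lemma continuous_Complex (T : topologicalType) (f g : T -> R) :
  continuous f -> continuous g -> continuous (fun x => Complex (f x) (g x)).
Proof.
move=> cf cg x; apply/cvgrPdist_lt => e e0.
(* the topology of R[i] uses radii in R[i]; positive ones are real *)
have [r eE] : exists r, e = r%:C%C.
  by exists (complex.Re e); rewrite RRe_real// gtr0_real.
move: e0; rewrite eE ltcR => r0.
have r20 : 0 < r / 2 by rewrite divr_gt0.
near=> y.
apply: le_lt_trans (normc_le_Re_Im _) _; rewrite ltcR /= (splitr r) ltrD//.
  by near: y; exact: (cvgrPdist_lt _ _).1 (cf x) _ r20.
by near: y; exact: (cvgrPdist_lt _ _).1 (cg x) _ r20.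
Unshelve. all: by end_near. Qed.

End complex_continuity.

(** * Positive definite functions *)

Section positive_definite_functions.
Context {R : realType} {H : groupType}.
Implicit Types (f g : H -> R[i]) (x y : H).

Lemma positive_definite_form2 f x (a b : R[i]) : positive_definite f ->
  0 <= f 1%g * (a * a^* + b * b^*) + f x * (a * b^*) + f x^-1%g * (b * a^*).
Proof.
move=> /(_ 2%N (tnth [tuple 1%g; x]) (tnth [tuple a; b])).
rewrite !big_ord_recl !big_ord0 /= !(tnth_nth 1%g) !(tnth_nth 0) /=.
rewrite !invg1 !mul1g !mulg1 mulVg !addr0.
by congr (_ <= _); rewrite mulrDr; ring.
Qed.

Lemma positive_definite1_ge0 f : positive_definite f -> 0 <= f 1%g.
Proof.
move=> /(@positive_definite_form2 _ 1%g 1 0).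
by rewrite !(conjC0, conjC1, mulr0, mul0r, mulr1, addr0).
Qed.

(** A form with only real values is Hermitian: polarization, with the
coefficient vectors (1, 1) and (1, i). *)
Lemma positive_definiteV f x : positive_definite f -> f x^-1%g = (f x)^*.
Proof.
move=> pf.
have f1 : (f 1%g)^* = f 1%g by apply/CrealP/ger0_real/positive_definite1_ge0.
have := CrealP (ger0_real (positive_definite_form2 x 1 'i pf)).
have := CrealP (ger0_real (positive_definite_form2 x 1 1 pf)).
rewrite conjCi conjC1 !(rmorphD, rmorphM, rmorphN) /= !(rmorphN, rmorph1) f1.
rewrite !conjCi !opprK; move: (f x^-1%g) (f x) (f 1%g) => v u m.
rewrite !(mulr1, mul1r) => h1 hi.
have e1 : u^* + v^* = u + v by apply: (addrI (m * (1 + 1))); rewrite !addrA.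
have e2 : u^* - v^* = v - u.
  apply: (mulIf (neq0Ci R[i])); apply: (addrI (m * (1 + - 'i * 'i))).
  rewrite !(mulrBl, mulrBr, mulrN, mulNr) in hi *; rewrite !addrA.
  by rewrite hi addrAC.
apply: (mulIf (_ : 2 != 0 :> R[i])); first by rewrite pnatr_eq0.
have -> : v * 2 = (u + v) + (v - u) by ring.
by rewrite -e1 -e2; ring.
Qed.

Lemma positive_definite_norm_le f x : positive_definite f ->
  `|f x| <= f 1%g.
Proof.
move=> pf; have [->|fx0] := eqVneq (f x) 0.
  by rewrite normr0 positive_definite1_ge0.
(* these coefficients align the cross terms: the form takes the value
   2|f x|^2 (f 1 - |f x|) *)
have := positive_definite_form2 x `|f x| (- f x) pf.
rewrite (positive_definiteV x pf) rmorphN /= (CrealP (normr_real _)).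
have n0 : 0 < `|f x| ^+ 2 *+ 2.
  by rewrite pmulrn_lgt0 // exprn_gt0 // normr_gt0.
rewrite [X in 0 <= X](_ : _ = (`|f x| ^+ 2 *+ 2) * (f 1%g - `|f x|)).
  by rewrite pmulr_rge0// subr_ge0.
have e : f x * (f x)^* = `|f x| ^+ 2 by rewrite normCK.
rewrite mulrNN e (_ : _ + _ + _ = f 1%g * (`|f x| ^+ 2 *+ 2)
  - (f x * (f x)^*) *+ 2 * `|f x|); last by ring.
by rewrite e; ring.
Qed.

(** In the Hilbert space where [f] is a matrix coefficient at a unit vector,
[f k = 1] is the equality case of Cauchy-Schwarz and forces [k] to fix that
vector. The same argument without the Hilbert space: the vectors at [1] and [k]
are at distance 0, and the form at [x^-1], [1], [k] would be negative if their
products with the vector at [x^-1] differed. *)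
Lemma positive_definite_translate f x k : positive_definite f ->
  f 1%g = 1 -> f k = 1 -> f (x * k)%g = f x.
Proof.
move=> pf f1 fk; apply/eqP; rewrite -subr_eq0; apply: contraT => d0.
pose d := f x - f (x * k)%g.
have d0' : `|d| ^+ 2 != 0.
  by rewrite expf_neq0 // normr_eq0 /d -opprB oppr_eq0.
(* coefficients (1, - b, b) give the value 1 - d b^* - d^* b = -1 *)
pose b := d / `|d| ^+ 2.
have := pf 3%N (tnth [tuple x^-1; 1; k]%g) (tnth [tuple 1; - b; b]).
rewrite !big_ord_recl !big_ord0 /= !(tnth_nth 1%g) !(tnth_nth 0) /=.
rewrite !invg1 !invgK !mul1g !mulg1 ?mulVg ?mulgV ?addr0.
rewrite (positive_definiteV k pf) -invgM !(positive_definiteV _ pf) f1 fk.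
rewrite rmorph1 rmorphN /=.
have db : d^* * b = 1 by rewrite /b mulrA (mulrC d^* ) -normCK divff.
have dbc : d * b^* = 1.
  by rewrite -[RHS](rmorph1 Num.conj) -db rmorphM /= conjCK.
rewrite [X in 0 <= X](_ : _ = 1 - d * b^* - d^* * b).
  by rewrite db dbc subrr add0r oppr_ge0 ler10.
by rewrite /d rmorphB /=; ring.
Qed.

End positive_definite_functions.

(** The spectral theorem, as a decomposition of a positive semidefinite matrix
into nonnegative multiples of matrices of rank one. *)
Lemma psd_spectral (C : numClosedFieldType) n (A : 'M[C]_n) :
  (forall k l, A l k = (A k l)^*) ->
  (forall a : 'I_n -> C,
    0 <= \sum_(k < n) \sum_(l < n) A k l * a k * (a l)^*) ->
  exists (d : 'I_n -> C) (p : 'I_n -> 'I_n -> C),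
    (forall r, 0 <= d r) /\
    forall k l, A k l = \sum_(r < n) d r * p r k * (p r l)^*.
Proof.
move=> Ah Apos.
have /hermitian_normalmx/orthomx_spectralP AE : A \is hermsymmx.
  apply/is_hermitianmxP; rewrite expr0 scale1r; apply/matrixP => k l.
  by rewrite !mxE -Ah.
set P := spectralmx A in AE; set D := spectral_diag A in AE.
have PU : P \is unitarymx := spectral_unitarymx A.
have Pinv : invmx P = (P ^t*)%sesqui by exact: invmx_unitary.
have PAP : P *m A *m (P^t*)%sesqui = diag_mx D.
  rewrite AE -Pinv !mulmxA mulmxV ?unitarymx_unit// mul1mx -mulmxA.
  by rewrite mulmxV ?unitarymx_unit// mulmx1.
have AklE k l : A k l = \sum_(r < n) D 0 r * (P r k)^* * P r l.
  rewrite {1}AE Pinv mxE; apply: eq_bigr => r _.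
  rewrite mxE (bigD1 r)//= big1 ?addr0; last first.
    by move=> s sr; rewrite !mxE (negPf sr) mulr0n mulr0.
  by rewrite !mxE eqxx mulr1n mulrAC (mulrC (D _ _)) mulrAC.
exists (fun r => D 0 r), (fun r k => (P r k)^*); split => [r|k l]; last first.
  by rewrite AklE; apply: eq_bigr => r _; rewrite conjCK.
(* the r-th eigenvalue is the value of the form at the r-th row of P *)
have <- : (diag_mx D) r r = D 0 r by rewrite mxE eqxx mulr1n.
rewrite -PAP mxE; have := Apos (fun k => P r k).
rewrite exchange_big /=; congr (_ <= _); apply: eq_bigr => l _.
rewrite !mxE mulr_suml; apply: eq_bigr => k _.
by rewrite (mulrC (A _ _)).
Qed.

(** Schur's product theorem: the entrywise product with a matrix of rank one
only rescales the coefficients of the form, so decompose [f] by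
[psd_spectral]. *)
Lemma positive_definiteM (R : realType) (H : groupType) (f g : H -> R[i]) :
  positive_definite f -> positive_definite g ->
  positive_definite (fun x => f x * g x).
Proof.
move=> pf pg n u a.
pose A := \matrix_(k < n, l < n) f ((u k)^-1 * u l)%g.
have [k l|b|d [p [d0 AE]]] := @psd_spectral _ n A.
- by rewrite !mxE -positive_definiteV // invgM invgK.
- by under eq_bigr do under eq_bigr do rewrite mxE; exact: pf.
have fE k l : f ((u k)^-1 * u l)%g = \sum_(r < n) d r * p r k * (p r l)^*.
  by rewrite -AE mxE.
suff -> : \sum_(k < n) \sum_(l < n)
    f ((u k)^-1 * u l)%g * g ((u k)^-1 * u l)%g * a k * (a l)^* =
  \sum_(r < n) d r * \sum_(k < n) \sum_(l < n)
    g ((u k)^-1 * u l)%g * (p r k * a k) * (p r l * a l)^*.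
  by apply: sumr_ge0 => r _; apply: mulr_ge0 => //; exact: pg.
under [RHS]eq_bigr do rewrite mulr_sumr.
rewrite [RHS]exchange_big /=; apply: eq_bigr => k _.
under [RHS]eq_bigr do rewrite mulr_sumr.
rewrite [RHS]exchange_big /=; apply: eq_bigr => l _.
rewrite fE !mulr_suml; apply: eq_bigr => r _.
by rewrite rmorphM /=; ring.
Qed.

Lemma positive_definite_comp (R : realType) (H H' : groupType)
    (theta : H -> H') (f : H' -> R[i]) :
  (forall x y, theta (x^-1 * y)%g = ((theta x)^-1 * theta y)%g) ->
  positive_definite f -> positive_definite (f \o theta).
Proof.
move=> thM pf n u a; have := pf n (theta \o u) a.
by under eq_bigr do under eq_bigr do rewrite /= -thM.
Qed.

(** * The dual space and its spherical functions *)

Section dual_space_topology.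
Context {R : realType} {G : topologicalGroupType} {K : compactSubgroup G}.
Context (omK : probability (borel (subgroup_type K)) R).

(** Local compactness of [G] makes evaluation jointly continuous for the
topology of compact convergence: a compact neighbourhood of [x] controls the
variation of the function uniformly. *)
Lemma dual_eval_continuous : locally_compact [set: G] ->
  continuous (fun p : dual_space omK * G => (p.1 : dual_space omK) p.2).
Proof.
move=> lcG [/= phi x].
apply/(@cvgrPdist_lt _ _ _ (nbhs (phi, x))) => e e0.
have e20 : 0 < e / 2 by rewrite divr_gt0.
have [//|V Vx [cV _]] := lcG x; rewrite withinET in Vx.
pose E : set (R[i] * R[i]) := [set p | `|p.1 - p.2| < e / 2].
have entE : entourage E by exact: (entourage_ball R[i] (PosNum e20)).
have valc : continuous (val : dual_space omK -> {family compact, G -> R[i]}).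
  exact: (@initial_continuous (dual_space omK)
    {family compact, G -> R[i]} set_val).
have phiV : nbhs phi
    [set psi | forall y, V y -> E (dual_fun phi y, dual_fun psi y)].
  exact: (valc phi _ (fam_nbhs (val phi) entE cV)).
have cphi : continuous (dual_fun phi).
  by have := set_valP phi; case => -[].
have phix : nbhs x [set y | `|dual_fun phi x - dual_fun phi y| < e / 2].
  exact: (iffLR (cvgrPdist_lt _ _) (cphi x)).
near=> p.
have [psiV [phiy Vy]] : (forall y, V y -> E (dual_fun phi y, dual_fun p.1 y)) /\
    `|dual_fun phi x - dual_fun phi p.2| < e / 2 /\ V p.2.
  near: p; exists
    ([set psi : dual_space omK |
        forall y, V y -> E (dual_fun phi y, dual_fun psi y)],
     [set y | `|dual_fun phi x - dual_fun phi y| < e / 2] `&` V).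
    by split => //; apply: filterI.
  by move=> [psi y] /= [].
rewrite (splitr e) -(subrKA (dual_fun phi p.2)) (le_lt_trans (ler_normD _ _))//.
by rewrite ltrD//; exact: psiV Vy.
Unshelve. all: by end_near. Qed.

Lemma dual_space_hausdorff : locally_compact [set: G] ->
  hausdorff_space (dual_space omK).
Proof.
move=> /dual_eval_continuous cev phi psi clpq.
apply: val_inj; apply/funext => x.
have cx : continuous (fun chi : dual_space omK => chi x).
  have cpair : continuous (fun chi : dual_space omK => (chi, x)).
    by apply: continuous_pairing;
      [move=> z; exact: cvg_id | exact: cst_continuous].
  exact: (continuous_compose cpair cev).
apply: (@norm_hausdorff _ R[i]) => A B nA nB.
have [chi [Achi Bchi]] := clpq _ _ (cx phi _ nA) (cx psi _ nB).
by exists (dual_fun chi x).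
Qed.

End dual_space_topology.

Lemma Rintegral_mulg (R : realType) (G : topologicalGroupType)
    (mu : {measure set (borel G) -> \bar R}) (k : G) (f : G -> R) :
  left_haar_measure mu -> continuous f ->
  mu.-integrable [set: borel G] (fun x => (f (k * x)%g)%:E) ->
  \int[mu]_(x in [set: borel G]) f (k * x)%g =
  \int[mu]_(x in [set: borel G]) f x.
Proof.
move=> [_ _ inv] cf iff.
pose tr (x : borel G) : borel G := (k * (x : G))%g.
have ctr : continuous (fun x : G => (k * x)%g).
  apply: continuous_mulg; first exact: cst_continuous.
  by move=> x; exact: cvg_id.
have mtr : measurable_fun setT tr by exact: borel_measurable_fun.
have mf : measurable_fun [set: borel G] (EFin \o f).
  apply/measurable_EFinP; apply: borel_measurable_within.
  by apply: continuous_subspaceT.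
rewrite /Rintegral; congr fine.
transitivity (\int[pushforward mu tr]_(x in [set: borel G]) (f x)%:E)%E.
  by rewrite (@integral_pushforward _ _ (borel G) (borel G) R tr mtr mu setT
    (EFin \o f)).
apply: eq_measure_integral => A mA _.
rewrite /pushforward -(inv k^-1%g A mA); congr (mu _).
apply/seteqP; split => x /=; rewrite /tr.
  by move=> Akx; exists (k * x)%g => //; rewrite mulKg.
by move=> [y Ay <-]; rewrite mulgA mulgV mul1g.
Qed.

Section spherical_functions.
Context {R : realType} {G : topologicalGroupType} {K : compactSubgroup G}.
Context (omK : probability (borel (subgroup_type K)) R)
  (haar_omK : left_haar_measure omK).

(** By left invariance of the Haar measure of [K], the functional equation at
[(k, 1)] and at [(1, 1)] evaluates the same integral. *)
Lemma positive_spherical_subgroup (phi : G -> R[i]) k :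
  positive_spherical omK phi -> (K : set G) k -> phi k = 1.
Proof.
move=> [[cphi phi1 sph] pphi] Kk.
pose k0 : subgroup_type K := exist _ k (mem_set Kk).
have cval : continuous (val : subgroup_type K -> G).
  exact: (@initial_continuous (set_type K) G set_val).
have cphiK : continuous (fun x : subgroup_type K => phi (val x)).
  exact: continuous_compose.
have phi_le1 x : `|phi x| <= 1.
  by rewrite -phi1; exact: positive_definite_norm_le.
have inv (p : R[i] -> R) : continuous p ->
    (forall z, `|p z| <= complex.Re `|z|) ->
    \int[omK]_(x in [set: borel (subgroup_type K)]) p (phi (val (k0 * x)%g)) =
    \int[omK]_(x in [set: borel (subgroup_type K)])
      p (phi (val (x : subgroup_type K))).
  move=> cp ple.
  have cpphi : continuous (fun x : subgroup_type K => p (phi (val x))).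
    exact: continuous_compose cphiK cp.
  apply: (@Rintegral_mulg _ (subgroup_type K) _ _
    (fun x => p (phi (val x)))) => //.
  have c1 : omK.-integrable [set: borel (subgroup_type K)] (EFin \o cst 1).
    exact: finite_measure_integrable_cst.
  apply: le_integrable c1 => //.
    apply/measurable_EFinP; apply: borel_measurable_within.
    apply: continuous_subspaceT; apply: (continuous_compose _ cpphi).
    apply: continuous_mulg; first exact: cst_continuous.
    by move=> x; exact: cvg_id.
  move=> x _; rewrite lee_fin normr1 (le_trans (ple _))//.
  by have := phi_le1 (val (k0 * x)%g); rewrite lecE => /andP[].
have := sph k 1%g; rewrite phi1 mulr1 => <-.
have := sph 1%g 1%g; rewrite phi1 mulr1 => <-.
transitivity (cintegral omK setT
    (fun x : borel (subgroup_type K) =>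
      phi (val (k0 * (x : subgroup_type K))%g))).
  by apply: eq_cintegral => x _; rewrite mulg1 valM.
transitivity (cintegral omK setT
    (fun x : borel (subgroup_type K) => phi (val (x : subgroup_type K)))).
  rewrite /cintegral; congr Complex; apply: inv.
  - exact: Re_continuous.
  - by move=> z; have := normc_ge_Re z; rewrite lecE => /andP[].
  - exact: Im_continuous.
  - by move=> z; have := normc_ge_Im z; rewrite lecE => /andP[].
by apply: eq_cintegral => x _; rewrite mulg1 mul1g.
Qed.

(** Since [phi] is 1 on [K], positive definiteness gives right invariance; left
invariance follows by inversion. *)
Lemma positive_spherical_biinvariant (phi : G -> R[i]) :
  positive_spherical omK phi -> biinvariant K phi.
Proof.
move=> sphi k k' x Kk Kk'; have [[_ phi1 _] pphi] := sphi.
have phiK y l : (K : set G) l -> phi (y * l)%g = phi y.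
  move=> Kl; apply: positive_definite_translate => //.
  exact: positive_spherical_subgroup.
rewrite phiK// -[(k * x)%g]invgK positive_definiteV// invgM.
rewrite phiK ?positive_definiteV ?conjCK//.
exact: subgroupV.
Qed.

End spherical_functions.

(** * Synthesis from the support of the Plancherel measure *)

Section within_product.
Context {T W U : topologicalType} (S : set T).

Lemma within_slice (f : T * W -> U) (w : W) :
  {within S `*` setT, continuous f} ->
  {within S, continuous (fun x => f (x, w))}.
Proof.
move=> /subspace_continuousP cf; apply/subspace_continuousP => x Sx A fA.
have := cf (x, w) (conj Sx I) A fA.
rewrite !nbhs_simpl /= => -[[P Q] /= [Px Qw] PQ].
apply: filterS Px => y Py Sy; apply: (PQ (y, w)) => //=; split => //.
exact: nbhs_singleton.
Qed.

Lemma within_comp_snd (V : topologicalType) (f : T * W -> U) (g : V -> W) :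
  continuous g -> {within S `*` setT, continuous f} ->
  {within S `*` setT, continuous (fun q : T * V => f (q.1, g q.2))}.
Proof.
move=> cg /subspace_continuousP cf.
apply/subspace_continuousP => -[x v] [/= Sx _] A fA.
have := cf (x, g v) (conj Sx I) A fA.
rewrite !nbhs_simpl /= => -[[P Q] /= [Px Qw] PQ].
exists (P, g @^-1` Q); first by split => //; exact: cg.
by move=> [y z] /= [Py Qz] [Sy _]; apply: (PQ (y, g z)).
Qed.

End within_product.

Section synthesis.
Context {R : realType} {G : topologicalGroupType} {K : compactSubgroup G}
  {L : topologicalGroupType}.
Context (omK : probability (borel (subgroup_type K)) R)
  (nu : {measure set (borel (dual_space omK)) -> \bar R})
  (h : dual_space omK -> L -> R[i]).
Context (lc_G : locally_compact [set: G]) (radon_nu : radon_measure nu)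
  (h_continuous : {within supp nu `*` [set: L],
     continuous (fun p : dual_space omK * L => h p.1 p.2)})
  (h_posdef : forall phi, supp nu phi -> continuous_positive_definite (h phi))
  (h_finite : (\int[nu]_(phi in supp nu) (complex.Re (h phi 1%g))%:E < +oo)%E).

Let mS : measurable (supp nu : set (borel (dual_space omK))).
Proof. exact: borel_closed (closed_supp (mu := nu)). Qed.

Lemma synthesis_within_continuous :
  {within supp nu `*` [set: G * L],
    continuous (fun q : dual_space omK * (G * L) => q.1 q.2.1 * h q.1 q.2.2)}.
Proof.
have cfst : continuous (@fst G L) by move=> x; exact: cvg_fst.
have csnd : continuous (@snd G L) by move=> x; exact: cvg_snd.
have ch := within_comp_snd csnd h_continuous.
have ce := within_comp_snd cfst
  (continuous_subspaceT (A := supp nu `*` setT)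
    (dual_eval_continuous (omK := omK) lc_G)).
by move=> q; apply: cvgM; [exact: ce | exact: ch].
Qed.

Lemma dominating_integrable :
  nu.-integrable (supp nu) (fun phi => (complex.Re (h phi 1%g))%:E).
Proof.
have mh : measurable_fun (supp nu : set (borel (dual_space omK)))
    (fun phi => (complex.Re (h phi 1%g))%:E).
  apply/measurable_EFinP; apply: borel_measurable_within.
  move=> x; apply: continuous_comp; last exact: Re_continuous.
  exact: within_slice h_continuous _.
apply/integrableP; split => //; apply: le_lt_trans h_finite.
apply: ge0_le_integral => //; first exact: measurableT_comp.
move=> phi /h_posdef[_ ph]; rewrite gee0_abs// lee_fin.
by have := positive_definite1_ge0 ph; rewrite lecE => /andP[].
Qed.

(** Both factors are at most their value at the neutral element, and
[phi 1 = 1]. *)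
Lemma synthesis_le phi w : supp nu phi ->
  `|dual_fun phi w.1 * h phi w.2| <= (complex.Re (h phi 1%g))%:C%C.
Proof.
move=> Sphi; have [_ ph] := h_posdef Sphi.
have [[_ phi1 _] pphi] := set_valP phi.
rewrite RRe_real ?ger0_real ?positive_definite1_ge0// normrM -[leRHS]mul1r.
apply: ler_pM => //; last exact: positive_definite_norm_le.
rewrite -phi1; exact: positive_definite_norm_le.
Qed.

(** The integral of a complex function is defined through its real and imaginary
parts; [p] stands for the projection to either. *)
Section component.
Context (p : R[i] -> R).
Context (cp : continuous p) (ple : forall z, `|p z| <= complex.Re `|z|).

Lemma component_le phi w : supp nu phi ->
  `|p (dual_fun phi w.1 * h phi w.2)| <= complex.Re (h phi 1%g).
Proof.
move=> /(synthesis_le w); rewrite lecE => /andP[_]; exact: le_trans (ple _).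
Qed.

Lemma component_within_continuous : {within supp nu `*` [set: G * L],
    continuous (fun q : dual_space omK * (G * L) =>
      p (q.1 q.2.1 * h q.1 q.2.2))}.
Proof.
move=> q; apply: continuous_comp; last exact: cp.
exact: synthesis_within_continuous.
Qed.

Lemma component_integrable (w : G * L) : nu.-integrable (supp nu)
  (fun phi => (p (dual_fun phi w.1 * h phi w.2))%:E).
Proof.
apply: le_integrable dominating_integrable => //.
  apply/measurable_EFinP; apply: borel_measurable_within.
  exact: within_slice component_within_continuous.
move=> phi Sphi; rewrite lee_fin (le_trans (component_le _ Sphi))//.
exact: ler_norm.
Qed.

Lemma component_continuous : continuous (fun w : G * L =>
  \int[nu]_(phi in supp nu) p (dual_fun phi w.1 * h phi w.2)).
Proof.
apply: (@continuous_Rintegral R (dual_space omK) (G * L)%type nu (supp nu)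
  (fun phi w => p (dual_fun phi w.1 * h phi w.2))
  (fun phi => complex.Re (h phi 1%g))) => //.
- exact: dual_space_hausdorff.
- exact: component_within_continuous.
- exact: component_integrable.
- by move=> phi w; exact: component_le.
- exact: dominating_integrable.
Qed.

End component.

End synthesis.

Unset Implicit Arguments.

Theorem proposition3p6 (R : realType)
  (G : topologicalGroupType) (K : compactSubgroup G) (L : topologicalGroupType)
  (omG : {measure set (borel G) -> \bar R})
  (omK : probability (borel (subgroup_type K)) R)
  (nu : {measure set (borel (dual_space omK)) -> \bar R})
  (h : dual_space omK -> L -> R[i])
  (haar_omG : left_haar_measure omG)
  (haar_omK : left_haar_measure omK)
  (gelfand_GK : gelfand_pair K omG)
  (plancherel_nu : plancherel_measure omG nu)
  (lc_L : locally_compact_group L)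
  (h_continuous : {within supp nu `*` [set: L],
     continuous (fun p : dual_space omK * L => h p.1 p.2)})
  (h_posdef : forall phi, supp nu phi -> continuous_positive_definite (h phi))
  (h_finite : (\int[nu]_(phi in supp nu) (complex.Re (h phi 1%g))%:E < +oo)%E) :
  (forall (x : G) (u : L),
     cintegrable nu (supp nu) (fun phi : dual_space omK => phi x * h phi u)) /\
  positive_definite_biinvariant K
    (fun p : G * L =>
       cintegral nu (supp nu)
         (fun phi : dual_space omK => phi p.1 * h phi p.2)).
Proof.
have [[_ lc_G] _] := gelfand_GK.
have [radon_nu _] := plancherel_nu.
have mS : measurable (supp nu : set (borel (dual_space omK))).
  exact: borel_closed (closed_supp (mu := nu)).
have leRe (z : R[i]) : `|complex.Re z| <= complex.Re `|z|.
  by have := normc_ge_Re z; rewrite lecE => /andP[].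
have leIm (z : R[i]) : `|complex.Im z| <= complex.Re `|z|.
  by have := normc_ge_Im z; rewrite lecE => /andP[].
have iC (w : G * L) : cintegrable nu (supp nu)
    (fun phi : dual_space omK => phi w.1 * h phi w.2).
  by split; apply: component_integrable => //;
    [exact: Re_continuous | exact: Im_continuous].
split; first by move=> x u; exact: (iC (x, u)).
split; last first.
  move=> k k' x u Kk Kk'; apply: eq_cintegral => phi _ /=.
  congr (_ * _).
  exact: (positive_spherical_biinvariant haar_omK (set_valP phi)).
split.
  by apply: continuous_Complex; apply: component_continuous => //;
    [exact: Re_continuous | exact: Im_continuous].
move=> n u a.
(* the form is the integral of the forms of the integrands *)
pose term k l (phi : dual_space omK) :=
  phi ((u k)^-1 * u l)%g.1 * h phi ((u k)^-1 * u l)%g.2 * (a k * (a l)^*).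
have iterm k l : cintegrable nu (supp nu) (term k l).
  by apply: cintegrableZr; [exact: mS | exact: iC].
rewrite [X in 0 <= X](_ : _ = cintegral nu (supp nu)
    (fun phi => \sum_(k < n) \sum_(l < n) term k l phi)); last first.
  rewrite cintegral_sum//; last by move=> k; exact: cintegrable_sum.
  apply: eq_bigr => k _; rewrite cintegral_sum//; apply: eq_bigr => l _.
  by rewrite cintegralZr// mulrA.
apply: cintegral_ge0 => phi Sphi.
have [_ ph] := h_posdef _ Sphi.
have [_ pphi] := set_valP phi.
have := positive_definiteM (positive_definite_comp (theta := @fst G L) _ pphi)
 (positive_definite_comp (theta := @snd G L) _ ph).
move=> /(_ (fun _ _ => erefl) (fun _ _ => erefl) n u a).
congr (_ <= _); apply: eq_bigr => k _; apply: eq_bigr => l _.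
by rewrite /term mulrA.
Qed.
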